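(* Let $M, N \ge 1$ be integers, let $R$ be a unital commutative ring, and let $G$ be a multiplicative subgroup of the group of units $R^\times$. Given any matrix $A \in R^{M \times N}$, there exist unique minimal (that is, coarsest) partitions $\pi_{\min} = \{I_1, \ldots, I_m\}$ of $\{1,\ldots,M\}$ and $\varpi_{\min} = \{J_1, \ldots, J_n\}$ of $\{1,\ldots,N\}$ such that, for all $i \in \{1,\ldots,m\}$ and $j \in \{1,\ldots,n\}$, the entries of the block submatrix $A_{I_i \times J_j}$ lie in a single $G$-orbit. Now suppose $M = N$. If either $A$ is symmetric, or $R = \mathbb{C}$, $G \subset S^1$ and $A$ is Hermitian, then $\pi_{\min} = \varpi_{\min}$.
   Context: $\Pi_N$ denotes the set of all partitions of $\{1,\ldots,N\}$, partially ordered by $\pi' \prec \pi$ if and only if $\pi$ is a refinement of $\pi'$ (so smaller means coarser); it is a lattice. Pairs in $\Pi_M \times \Pi_N$ are compared coordinatewise. For a partition into row sets $I_i$ and column sets $J_j$, $A_{I_i \times J_j}$ is the submatrix of $A$ with rows indexed by $I_i$ and columns indexed by $J_j$. The group $G$ acts on $R$ by multiplication; the $G$-orbit of $a\in R$ is $Ga=\{ga : g \in G\}$. $S^1$ is the unit circle in $\mathbb{C}$. *)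

(* Defs.v *)
From HB Require Import structures.
From mathcomp Require Import all_boot all_order all_algebra.
From mathcomp Require Import classical_sets reals.
From mathcomp Require Import complex.

Set Implicit Arguments.
Unset Strict Implicit.
Unset Printing Implicit Defensive.

Import Order.TTheory GRing.Theory Num.Theory.
Local Open Scope classical_set_scope.
Local Open Scope ring_scope.

(* Partitions of {1, ..., N}, with 'I_N as index set. *)
Definition set_partition (N : nat) : Type :=
  {P : {set {set 'I_N}} | finset.partition P [set: 'I_N]%SET}.

(* [coarser P Q]: the partition Q is a refinement of P (non-strict order). *)
Definition coarser (N : nat) (P Q : set_partition N) : Prop :=
  forall J : {set 'I_N}, J \in val Q ->
    exists2 I : {set 'I_N}, I \in val P & J \subset I.

Definition coarser_pair (M N : nat)
    (p q : set_partition M * set_partition N) : Prop :=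
  coarser p.1 q.1 /\ coarser p.2 q.2.

(* Multiplicative subgroups of the group of units, for a commutative ring that
   is possibly trivial and has no decidable unit predicate: closure under
   inverses already forces the elements of G to be units. *)
Definition unit_subgroup (R : comPzRingType) (G : set R) : Prop :=
  [/\ G 1,
      forall x y, G x -> G y -> G (x * y)
    & forall x, G x -> exists2 y, G y & x * y = 1].

Definition mul_orbit (R : comPzRingType) (G : set R) (a : R) : set R :=
  [set g * a | g in G].

Definition single_orbit_blocks (M N : nat) (R : comPzRingType) (G : set R)
    (A : 'M[R]_(M, N)) (p : set_partition M * set_partition N) : Prop :=
  forall (I : {set 'I_M}) (J : {set 'I_N}), I \in val p.1 -> J \in val p.2 ->
    exists a : R, forall i j, i \in I -> j \in J -> mul_orbit G a (A i j).

Definition minimal_pair (M N : nat) (R : comPzRingType) (G : set R)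
    (A : 'M[R]_(M, N)) (p : set_partition M * set_partition N) : Prop :=
  single_orbit_blocks G A p /\
  forall q, single_orbit_blocks G A q -> coarser_pair q p -> q = p.

(* Main.v *)
Require Import Defs.
From mathcomp Require Import all_boot all_order all_algebra.
From mathcomp Require Import boolp classical_sets reals.
From mathcomp Require Import complex.

(** Call a pair of partitions admissible when the entries of each block
    [A_(I x J)] lie in one orbit.  This condition decouples into a condition on
    rows and a condition on columns.  The orbits of a group are
    the classes of an equivalence relation, so call two rows [i], [i'] of [A]
    equivalent when [A i j] and [A i' j] are in the same orbit for every column
    [j], and two columns equivalent when they are equivalent rows of [A^T].

    Two rows in a common block of an admissible pair are equivalent: each column
    [j] lies in some block, and the two entries belong to the corresponding
    submatrix.  Hence an admissible pair refines the pair of partitions into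
    classes of rows and of columns ([single_orbit_blocks_row_coarser]).
    Conversely that pair is admissible, since one passes from [A i j] to
    [A i' j'] through [A i' j] ([single_orbit_blocks_row_col]).  It is therefore
    the least admissible pair, and a least element is the only minimal one
    ([minimal_pairE]).

    Since the column partition of [A] is the row partition of [A^T], the two
    components agree for symmetric [A].  For Hermitian [A] the transpose is the
    entrywise conjugate of [A]; conjugation preserves lying in the same orbit
    because it acts on the unit circle, hence on [G], as inversion. *)

Set Implicit Arguments.
Unset Strict Implicit.
Unset Printing Implicit Defensive.

Import GRing.Theory Num.Theory.
Local Open Scope classical_set_scope.
Local Open Scope ring_scope.

Lemma mul_orbit_refl (R : comPzRingType) (G : set R) (a : R) :
  unit_subgroup G -> mul_orbit G a a.
Proof. by case=> G1 _ _; exists 1 => //; rewrite mul1r. Qed.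

Lemma mul_orbit_sym (R : comPzRingType) (G : set R) (a b : R) :
  unit_subgroup G -> mul_orbit G a b -> mul_orbit G b a.
Proof.
move=> [_ _ GV] [g Gg <-]; have [h Gh gh1] := GV g Gg.
by exists h => //; rewrite mulrA (mulrC h) gh1 mul1r.
Qed.

Lemma mul_orbit_trans (R : comPzRingType) (G : set R) (a b c : R) :
  unit_subgroup G -> mul_orbit G a b -> mul_orbit G b c -> mul_orbit G a c.
Proof.
move=> [_ GM _] [g Gg <-] [h Gh <-].
by exists (h * g); [exact: GM | rewrite mulrA].
Qed.

(** On the unit circle the conjugate of [g] is its inverse, so it stays in any
    subgroup containing [g]. *)
Lemma unit_circle_subgroup_conj (C : numClosedFieldType) (G : set C) (g : C) :
  unit_subgroup G -> G `<=` [set z | `|z| = 1] -> G g -> G g^*.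
Proof.
move=> [_ _ GV] Gcirc Gg; have [h Gh gh1] := GV g Gg.
suff -> : g^* = h by [].
have /= g1 := Gcirc g Gg.
have g0 : g != 0 by rewrite -normr_eq0 g1 oner_eq0.
by apply: (mulfI g0); rewrite gh1 -normCK g1 expr1n.
Qed.

Lemma mul_orbit_conj (C : numClosedFieldType) (G : set C) (a b : C) :
  unit_subgroup G -> G `<=` [set z | `|z| = 1] ->
  mul_orbit G a b -> mul_orbit G a^* b^*.
Proof.
move=> hG Gcirc [g Gg <-]; exists g^*; last by rewrite rmorphM.
exact: unit_circle_subgroup_conj.
Qed.

Lemma set_partition_block_subset (N : nat) (P : set_partition N)
    (I J : {set 'I_N}) :
  I \in val P -> J \in val P -> I \subset J -> I = J.
Proof.
have /and3P[_ tiP P0] := valP P => PI PJ sIJ.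
have /finset.set0Pn[x Ix] : I != finset.set0.
  by apply: contraNneq P0 => <-.
by rewrite -(def_pblock tiP PI Ix) (def_pblock tiP PJ (fintype.subsetP sIJ x Ix)).
Qed.

(** A block of [Q] sits in a block of [P], itself in a block of [Q]; the outer
    two coincide, so all three do. *)
Lemma coarser_blocks_sub (N : nat) (P Q : set_partition N) (J : {set 'I_N}) :
  coarser P Q -> coarser Q P -> J \in val Q -> J \in val P.
Proof.
move=> PQ QP QJ; have [I PI sJI] := PQ J QJ; have [J' QJ' sIJ'] := QP I PI.
have JJ' := set_partition_block_subset QJ QJ' (fintype.subset_trans sJI sIJ').
suff -> : J = I by [].
by apply/eqP; rewrite finset.eqEsubset sJI JJ' sIJ'.
Qed.

Lemma coarser_anti (N : nat) (P Q : set_partition N) :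
  coarser P Q -> coarser Q P -> P = Q.
Proof.
move=> PQ QP; apply/val_inj/finset.setP => J.
by apply/idP/idP; apply: coarser_blocks_sub.
Qed.

Lemma set_partition_cover (N : nat) (P : set_partition N) (i : 'I_N) :
  exists2 I : {set 'I_N}, I \in val P & i \in I.
Proof.
have /and3P[/eqP covP _ _] := valP P.
have Pi : i \in finset.cover (val P) by rewrite covP finset.in_setT.
by exists (finset.pblock (val P) i); rewrite ?pblock_mem ?mem_pblock.
Qed.

Definition same_row_orbits (M N : nat) (R : comPzRingType) (G : set R)
    (A : 'M[R]_(M, N)) : rel 'I_M :=
  fun i i' => `[< forall j, mul_orbit G (A i j) (A i' j) >].

Lemma same_row_orbits_equiv (M N : nat) (R : comPzRingType) (G : set R)
    (A : 'M[R]_(M, N)) :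
  unit_subgroup G -> equivalence_rel (same_row_orbits G A).
Proof.
move=> hG i i' i''; split; first by apply/asboolP => j; apply: mul_orbit_refl.
move=> /asboolP ii'; apply/asboolP/asboolP => H j.
  exact: mul_orbit_trans hG (mul_orbit_sym hG (ii' j)) (H j).
exact: mul_orbit_trans hG (ii' j) (H j).
Qed.

Definition row_partition (M N : nat) (R : comPzRingType) (G : set R)
    (hG : unit_subgroup G) (A : 'M[R]_(M, N)) : set_partition M :=
  exist _ (equivalence_partition (same_row_orbits G A) [set: 'I_M]%SET)
    (equivalence_partitionP (in3W (same_row_orbits_equiv A hG))).

Lemma row_partition_block (M N : nat) (R : comPzRingType) (G : set R)
    (hG : unit_subgroup G) (A : 'M[R]_(M, N)) (I : {set 'I_M}) (i i' : 'I_M) :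
  I \in val (row_partition hG A) -> i \in I ->
  (i' \in I) = same_row_orbits G A i i'.
Proof.
have eqA : {in [set: 'I_M]%SET & &, equivalence_rel (same_row_orbits G A)}.
  exact: in3W (same_row_orbits_equiv A hG).
have /and3P[_ tiP _] := valP (row_partition hG A) => PI Ii.
rewrite -(def_pblock tiP PI Ii).
by rewrite (pblock_equivalence_partition eqA) ?finset.in_setT.
Qed.

(** The form of admissibility used below, free of orbit representatives: the
    orbits are equivalence classes, so any entry of a block represents the orbit
    of all the others. *)
Lemma single_orbit_blocksP (M N : nat) (R : comPzRingType) (G : set R)
    (A : 'M[R]_(M, N)) (p : set_partition M * set_partition N) :
  unit_subgroup G ->
  single_orbit_blocks G A p <->
  forall (I : {set 'I_M}) (J : {set 'I_N}) i i' j j',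
    I \in val p.1 -> J \in val p.2 -> i \in I -> i' \in I -> j \in J -> j' \in J ->
    mul_orbit G (A i j) (A i' j').
Proof.
move=> hG; split=> [H I J i i' j j' PI QJ Ii Ii' Jj Jj' | H I J PI QJ].
  have [a Ha] := H I J PI QJ.
  exact: mul_orbit_trans hG (mul_orbit_sym hG (Ha i j Ii Jj)) (Ha i' j' Ii' Jj').
have [-> | [i Ii]] := finset.set_0Vmem I.
  (* An empty index set imposes no condition, so any representative will do. *)
  by exists 0 => i j; rewrite finset.in_set0.
have [-> | [j Jj]] := finset.set_0Vmem J.
  by exists 0 => ? j; rewrite finset.in_set0.
by exists (A i j) => i' j' Ii' Jj'; apply: (H I J).
Qed.

Lemma single_orbit_blocks_tr (M N : nat) (R : comPzRingType) (G : set R)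
    (A : 'M[R]_(M, N)) (P : set_partition M) (Q : set_partition N) :
  single_orbit_blocks G A (P, Q) -> single_orbit_blocks G A^T (Q, P).
Proof.
move=> H J I QJ PI; have [a Ha] := H I J PI QJ.
by exists a => j i Jj Ii; rewrite mxE; apply: Ha.
Qed.

(** Rows [i], [i'] in one block of [p.1] are equivalent because every column is
    covered by some block of [p.2], so that at each [j] the two entries share a
    submatrix. *)
Lemma single_orbit_blocks_row_coarser (M N : nat) (R : comPzRingType)
    (G : set R) (hG : unit_subgroup G) (A : 'M[R]_(M, N))
    (p : set_partition M * set_partition N) :
  single_orbit_blocks G A p -> coarser (row_partition hG A) p.1.
Proof.
move=> /(single_orbit_blocksP _ _ hG) H I PI.
have /and3P[_ _ P0] := valP p.1.
have /finset.set0Pn[i Ii] : I != finset.set0.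
  by apply: contraNneq P0 => <-.
have [K PK Ki] := set_partition_cover (row_partition hG A) i.
exists K => //; apply/fintype.subsetP => i' Ii'.
rewrite (row_partition_block _ PK Ki); apply/asboolP => j.
have [J QJ Jj] := set_partition_cover p.2 j.
exact: (H I J).
Qed.

(** One moves along column [j] from row [i] to row [i'], then along row [i']
    from column [j] to column [j']. *)
Lemma single_orbit_blocks_row_col (M N : nat) (R : comPzRingType) (G : set R)
    (hG : unit_subgroup G) (A : 'M[R]_(M, N)) :
  single_orbit_blocks G A (row_partition hG A, row_partition hG A^T).
Proof.
apply/(single_orbit_blocksP _ _ hG) => I J i i' j j' PI QJ Ii Ii' Jj Jj'.
have /asboolP rows : same_row_orbits G A i i'.
  by rewrite -(row_partition_block _ PI Ii).
have /asboolP/(_ i') : same_row_orbits G A^T j j'.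
  by rewrite -(row_partition_block _ QJ Jj).
by rewrite !mxE; apply: mul_orbit_trans hG (rows j).
Qed.

Lemma single_orbit_blocks_coarser_pair (M N : nat) (R : comPzRingType)
    (G : set R) (hG : unit_subgroup G) (A : 'M[R]_(M, N))
    (p : set_partition M * set_partition N) :
  single_orbit_blocks G A p ->
  coarser_pair (row_partition hG A, row_partition hG A^T) p.
Proof.
case: p => P Q H; split; first exact: single_orbit_blocks_row_coarser H.
exact: (single_orbit_blocks_row_coarser hG (single_orbit_blocks_tr H)).
Qed.

(** The pair of row and column classes is below every admissible pair, so a
    minimal pair, being above it, must equal it; antisymmetry of the order makes
    this least pair itself minimal. *)
Lemma minimal_pairE (M N : nat) (R : comPzRingType) (G : set R)
    (hG : unit_subgroup G) (A : 'M[R]_(M, N))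
    (p : set_partition M * set_partition N) :
  minimal_pair G A p <-> p = (row_partition hG A, row_partition hG A^T).
Proof.
split=> [[Hp minp] | ->].
  rewrite -(minp _ (single_orbit_blocks_row_col (A := A) (hG := hG))) //.
  exact: single_orbit_blocks_coarser_pair.
split=> [|[P Q] HPQ [/= PA QA]]; first exact: single_orbit_blocks_row_col.
have [/= AP AQ] := single_orbit_blocks_coarser_pair hG HPQ.
by rewrite (coarser_anti PA AP) (coarser_anti QA AQ).
Qed.

Lemma row_partition_eq (M N N' : nat) (R : comPzRingType) (G : set R)
    (hG : unit_subgroup G) (A : 'M[R]_(M, N)) (B : 'M[R]_(M, N')) :
  same_row_orbits G A =2 same_row_orbits G B ->
  row_partition hG A = row_partition hG B.
Proof.
move=> eqAB; apply: val_inj; apply: finset.eq_imset => i /=.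
by apply/finset.setP => i'; rewrite !inE eqAB.
Qed.

Lemma hermsymmx_tr_entry (C : numClosedFieldType) (N : nat) (A : 'M[C]_N) i j :
  A \is hermsymmx -> A i j = (A j i)^*.
Proof.
by rewrite is_hermitianmxE expr0 scale1r => /eqP {1}->; rewrite !mxE.
Qed.

(** Row [i] of [A^T] is the conjugate of row [i] of [A], and conjugation carries
    orbits to orbits, so both matrices have the same equivalent rows. *)
Lemma hermsymmx_row_partition_tr (C : numClosedFieldType) (N : nat)
    (G : set C) (hG : unit_subgroup G) (A : 'M[C]_N) :
  G `<=` [set z | `|z| = 1] -> A \is hermsymmx ->
  row_partition hG A = row_partition hG A^T.
Proof.
move=> Gcirc hA; apply: row_partition_eq => i i'.
apply/asboolP/asboolP => H j; have := mul_orbit_conj hG Gcirc (H j).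
  by rewrite !mxE -!(hermsymmx_tr_entry _ _ hA).
by rewrite !mxE -!(hermsymmx_tr_entry _ _ hA).
Qed.

Theorem theorem2p3 :
  (forall (M N : nat) (R : comPzRingType) (G : set R) (A : 'M[R]_(M, N)),
     (1 <= M)%N -> (1 <= N)%N -> unit_subgroup G ->
     exists! p : set_partition M * set_partition N, minimal_pair G A p)
  /\
  (forall (N : nat) (R : comPzRingType) (G : set R) (A : 'M[R]_N)
      (pi_min varpi_min : set_partition N),
     (1 <= N)%N -> unit_subgroup G -> minimal_pair G A (pi_min, varpi_min) ->
     A^T = A ->
     pi_min = varpi_min)
  /\
  (forall (T : realType) (N : nat) (G : set T[i]) (A : 'M[T[i]]_N)
      (pi_min varpi_min : set_partition N),
     (1 <= N)%N -> unit_subgroup G -> minimal_pair G A (pi_min, varpi_min) ->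
     G `<=` [set z | `|z| = 1] -> A \is hermsymmx ->
     pi_min = varpi_min).
Proof.
split; [|split].
- move=> M N R G A _ _ hG.
  exists (row_partition hG A, row_partition hG A^T); split=> [|p].
    exact/(minimal_pairE hG).
  by move=> /(minimal_pairE hG).
- move=> N R G A P Q _ hG /(minimal_pairE hG) PQ symA.
  by move: PQ; rewrite symA => -[-> ->].
- move=> T N G A P Q _ hG /(minimal_pairE hG)[-> ->] Gcirc hA.
  exact: hermsymmx_row_partition_tr.
Qed.
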